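(* Let $m,n\ge1$ be integers and let $\mathbf{p}(\mathbf{s})=\sum_{|\mathbf{i}|=n}\mathbf{c}_{\mathbf{i}}B^n_{\mathbf{i}}(\mathbf{s})$ be a triangular Bézier surface of degree $n$ in $\mathbb{R}^3$, expressed in barycentric coordinates with respect to a fixed non-degenerate tetrahedron $\Lambda$. Let $\mathbf{M}=(m_{\mathbf{i},\mathbf{j}})_{|\mathbf{i}|=m,|\mathbf{j}|=m}$ be the $\binom{m+3}{3}\times\binom{m+3}{3}$ matrix of weak approximate implicitization, $$m_{\mathbf{i},\mathbf{j}}=\int_\Omega B^m_{\mathbf{i}}(\mathbf{p}(\mathbf{s}))\,B^m_{\mathbf{j}}(\mathbf{p}(\mathbf{s}))\,\mathrm{d}\mathbf{s}.$$ Then $\mathbf{M}$ is determined by the $\binom{2m+3}{3}$ integrals $$I_{\mathbf{k}}=\int_\Omega B^{2m}_{\mathbf{k}}(\mathbf{p}(\mathbf{s}))\,\mathrm{d}\mathbf{s},\qquad |\mathbf{k}|=2m,$$ (where $\mathbf{k}$ runs over the $\binom{2m+3}{3}$ four-entry multi-indices of degree $2m$) through $$m_{\mathbf{i},\mathbf{j}}=\frac{\binom{m}{\mathbf{i}}\binom{m}{\mathbf{j}}}{\binom{2m}{\mathbf{i}+\mathbf{j}}}\,I_{\mathbf{i}+\mathbf{j}}\qquad\text{for all }|\mathbf{i}|=|\mathbf{j}|=m.$$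
   Context: Barycentric coordinates. A point $\mathbf{x}\in\mathbb{R}^l$ has barycentric coordinates $\bm{\beta}=(\beta_1,\dots,\beta_{l+1})$ with respect to a non-degenerate simplex with vertices $\mathbf{a}_1,\dots,\mathbf{a}_{l+1}$ if $\mathbf{x}=\sum_i\beta_i\mathbf{a}_i$ and $\sum_i\beta_i=1$. Points of the triangle $\Omega$ are written $\mathbf{s}=(s_1,s_2,s_3)$, $s_k\ge0$, $s_1+s_2+s_3=1$; points of $\mathbb{R}^3$ are written in barycentric coordinates $\mathbf{u}=(u_1,u_2,u_3,u_4)$ with respect to the tetrahedron $\Lambda$. $\int_\Omega\cdot\,\mathrm{d}\mathbf{s}$ is integration over the triangle $\Omega$ with respect to area measure (with any fixed normalization, the same in all integrals). Multi-indices and Bernstein polynomials. Multi-indices have non-negative integer entries (three entries for polynomials in $\mathbf{s}$, four for polynomials in $\mathbf{u}$); $|\mathbf{i}|$ is the sum of the entries, $\mathbf{i}+\mathbf{j}$ is the entrywise sum, $\bm{\beta}^{\mathbf{i}}=\prod_k\beta_k^{i_k}$, $\binom{n}{\mathbf{i}}=\frac{n!}{\prod_k i_k!}$ for $|\mathbf{i}|=n$, and $B^n_{\mathbf{i}}(\bm{\beta})=\binom{n}{\mathbf{i}}\bm{\beta}^{\mathbf{i}}$. Bézier triangle. The control points $\mathbf{c}_{\mathbf{i}}$ are points of $\mathbb{R}^3$, given by their barycentric coordinates with respect to $\Lambda$; thus $\mathbf{p}(\mathbf{s})=(p_1(\mathbf{s}),\dots,p_4(\mathbf{s}))$ and, for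 a four-entry multi-index $\mathbf{i}$ with $|\mathbf{i}|=N$, $B^N_{\mathbf{i}}(\mathbf{p}(\mathbf{s}))=\binom{N}{\mathbf{i}}\prod_{k=1}^4p_k(\mathbf{s})^{i_k}$. *)

(* Defs.v *)
From HB Require Import structures.
From mathcomp Require Import all_boot all_order all_algebra.
From mathcomp Require Import all_classical all_reals all_analysis.
Set Implicit Arguments.
Unset Strict Implicit.
Unset Printing Implicit Defensive.
Import Order.TTheory GRing.Theory Num.Theory.
Local Open Scope ring_scope.

Definition nondegenerate_simplex (R : realType) (l : nat) (a : 'I_l.+1 -> 'rV[R]_l) :
    bool :=
  (\matrix_(i < l) (a (lift ord0 i) - a ord0)) \in unitmx.

Definition is_barycentric (R : realType) (l : nat) (a : 'I_l.+1 -> 'rV[R]_l)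
    (x : 'rV[R]_l) (b : 'rV[R]_l.+1) : Prop :=
  x = \sum_i b 0 i *: a i /\ \sum_i b 0 i = 1.

(* When a is non-degenerate, the coordinates exist (barycentricP) and are
   unique (barycentric_unique), so the default value 0 is never used. *)
Definition barycentric (R : realType) (l : nat) (a : 'I_l.+1 -> 'rV[R]_l)
    (x : 'rV[R]_l) : 'rV[R]_l.+1 :=
  xget 0 [set b | is_barycentric a x b]%classic.

Lemma is_barycentricE (R : realType) (l : nat) (a : 'I_l.+1 -> 'rV[R]_l)
    (x : 'rV[R]_l) (b : 'rV[R]_l.+1) :
  is_barycentric a x b <->
  x - a ord0 = (\row_i b 0 (lift ord0 i)) *m
                 (\matrix_(i < l) (a (lift ord0 i) - a ord0))
  /\ b 0 ord0 = 1 - \sum_i b 0 (lift ord0 i).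
Proof.
have -> : (\row_i b 0 (lift ord0 i)) *m
    (\matrix_(i < l) (a (lift ord0 i) - a ord0)) =
    \sum_i b 0 (lift ord0 i) *: a (lift ord0 i)
      - (\sum_i b 0 (lift ord0 i)) *: a ord0.
  rewrite mulmx_sum_row scaler_suml -sumrB; apply: eq_bigr => i _.
  by rewrite mxE rowK scalerBr.
rewrite /is_barycentric !big_ord_recl /=.
set S := \sum_i _ *: _; set s := \sum_i b 0 _.
split=> [[-> /(canRL (addrK s)) ->]|[h ->]]; rewrite scalerBl scale1r.
  by split=> //; rewrite addrC addrA addrA addNr add0r addrC.
by rewrite subrK; split=> //; rewrite -[x](subrK (a ord0)) h addrC addrAC addrA.
Qed.

Lemma barycentricP (R : realType) (l : nat) (a : 'I_l.+1 -> 'rV[R]_l)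
    (x : 'rV[R]_l) :
  nondegenerate_simplex a -> is_barycentric a x (barycentric a x).
Proof.
move=> ua; apply: (xgetPex 0 (P := [set b | is_barycentric a x b]%classic)).
pose y := (x - a ord0) *m invmx (\matrix_(i < l) (a (lift ord0 i) - a ord0)).
exists (\row_j if unlift ord0 j is Some i then y 0 i else 1 - \sum_i y 0 i).
rewrite /= is_barycentricE; split.
  rewrite -[LHS](mulmxKV ua); congr (_ *m _).
  by apply/rowP => i; rewrite !mxE liftK mxE.
rewrite mxE unlift_none; congr (_ - _).
by apply: eq_bigr => i _; rewrite mxE liftK.
Qed.

Lemma barycentric_unique (R : realType) (l : nat) (a : 'I_l.+1 -> 'rV[R]_l)
    (x : 'rV[R]_l) (b : 'rV[R]_l.+1) :
  nondegenerate_simplex a -> is_barycentric a x b -> barycentric a x = b.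
Proof.
move=> ua; have := barycentricP x ua; move: (barycentric a x) => b'.
rewrite !is_barycentricE => -[h1 h2] [h3 h4].
have E : \row_i b' 0 (lift ord0 i) = \row_i b 0 (lift ord0 i).
  by apply: (can_inj (mulmxK ua)); rewrite -h1 -h3.
have Ei i : b' 0 (lift ord0 i) = b 0 (lift ord0 i).
  by move/rowP/(_ i): E; rewrite !mxE.
apply/rowP => j; case: (unliftP ord0 j) => [i ->|->]; first exact: Ei.
by rewrite h2 h4; congr (_ - _); apply: eq_bigr.
Qed.

(* Multi-indices with d entries and degree N.  The entries, being at most N, are
   taken in 'I_N.+1 to make the type finite. *)
Record mindex (d N : nat) := Mindex {
  mentry :> {ffun 'I_d -> 'I_N.+1};
  _ : (\sum_k (mentry k : nat) == N)%N
}.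

HB.instance Definition _ d N := [isSub for @mentry d N].
HB.instance Definition _ d N := [Finite of mindex d N by <:].

Lemma mindex_add_subproof (d N : nat) (i j : mindex d N) :
  (\sum_k ([ffun k => inord (i k + j k)] : {ffun 'I_d -> 'I_(2 * N).+1}) k
    == 2 * N)%N.
Proof.
case: i j => [i /= /eqP hi] [j /= /eqP hj].
apply/eqP; transitivity (\sum_k (i k + j k))%N.
  apply: eq_bigr => k _.
  by rewrite ffunE inordK // mul2n -addnn ltnS leq_add // -ltnS ltn_ord.
by rewrite big_split /= hi hj addnn mul2n.
Qed.

(* The entrywise sum of i and j; inord never truncates (mindex_addE). *)
Definition mindex_add (d N : nat) (i j : mindex d N) : mindex d (2 * N) :=
  Mindex (mindex_add_subproof i j).

Lemma mindex_addE (d N : nat) (i j : mindex d N) (k : 'I_d) :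
  mindex_add i j k = (i k + j k)%N :> nat.
Proof.
by rewrite ffunE inordK // mul2n -addnn ltnS leq_add // -ltnS ltn_ord.
Qed.

Definition multinomial_coef (R : realType) (d N : nat) (i : mindex d N) : R :=
  N`!%:R / \prod_k (i k)`!%:R.

Definition bernstein (R : realType) (d N : nat) (i : mindex d N)
    (b : 'rV[R]_d) : R :=
  multinomial_coef R i * \prod_k b 0 k ^+ i k.

(* The surface p(s), in barycentric coordinates with respect to the tetrahedron
   Lam, as a function of the barycentric coordinates s of the parameter point. *)
Definition bezier_triangle (R : realType) (n : nat) (Lam : 'I_4 -> 'rV[R]_3)
    (c : mindex 3 n -> 'rV[R]_3) (s : 'rV[R]_3) : 'rV[R]_4 :=
  \sum_(i : mindex 3 n) bernstein i s *: barycentric Lam (c i).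

Definition plane_point (R : realType) (x : R * R) : 'rV[R]_2 :=
  \row_j (if j == ord0 then x.1 else x.2).

Definition triangle (R : realType) (a : 'I_3 -> 'rV[R]_2) : set (R * R) :=
  [set x | exists2 s : 'rV[R]_3, forall k, 0 <= s 0 k &
           is_barycentric a (plane_point x) s]%classic.

(* The integral over the triangle with vertices a of a function f of barycentric
   coordinates, with respect to w times the Lebesgue area measure. *)
Definition triangle_integral (R : realType) (w : R) (a : 'I_3 -> 'rV[R]_2)
    (f : 'rV[R]_3 -> R) : R :=
  w * \int[(@lebesgue_measure R \x @lebesgue_measure R)%E]_(x in triangle a)
        f (barycentric a (plane_point x)).

(* The rows and columns are indexed by the multi-indices of degree m through
   their enumeration: the entry (i, j) is found at (enum_rank i, enum_rank j). *)
Definition implicitization_matrix (R : realType) (w : R)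
    (a : 'I_3 -> 'rV[R]_2) (p : 'rV[R]_3 -> 'rV[R]_4) (m : nat) :
    'M[R]_#|{: mindex 4 m}| :=
  \matrix_(r, t) triangle_integral w a (fun s =>
    bernstein (enum_val r : mindex 4 m) (p s) *
    bernstein (enum_val t : mindex 4 m) (p s)).

Definition bernstein_integral (R : realType) (w : R) (a : 'I_3 -> 'rV[R]_2)
    (p : 'rV[R]_3 -> 'rV[R]_4) (N : nat) (k : mindex 4 N) : R :=
  triangle_integral w a (fun s => bernstein k (p s)).

(* Main.v *)
Require Import Defs.
From HB Require Import structures.
From mathcomp Require Import all_boot all_order all_algebra.
From mathcomp Require Import all_classical all_reals all_analysis.
Import Order.TTheory GRing.Theory Num.Theory.
Local Open Scope ring_scope.

(** A product of two Bernstein polynomials of degree [m] has the monomial part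
    of a Bernstein polynomial of degree [2 * m], because exponents add, so the
    two differ by a quotient of multinomial coefficients ([bernsteinM]).  This
    holds at every point, in particular along the surface, and integration
    preserves it as soon as the constant can be taken out of the integral.

    The constant is positive, and positive constants come out of the integral
    of any function at all ([integral_pZl]): multiplication by [k > 0] is an
    order automorphism of the extended reals, so it transports the simple
    functions below a nonnegative [f] onto those below [k * f].  Hence no
    measurability or integrability of the polynomials in the barycentric
    coordinates has to be established.

    The two cardinalities are instances of the count of weak compositions of
    [N] into [d.+1] parts ([card_mindex]). *)

Lemma card_mindex (d N : nat) : #|{: mindex d.+1 N}| = 'C(N + d, d).
Proof.
rewrite [(N + d)%N]addnC -card_ord_partitions.
pose tup (i : mindex d.+1 N) := [tuple i k | k < d.+1].
have tup_inj : injective tup.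
  move=> i j eqij; apply/val_inj/ffunP => k.
  by rewrite -(tnth_mktuple i k) -(tnth_mktuple j k) -/(tup i) eqij.
rewrite -(card_codom tup_inj) -[RHS]cardsE; apply: eq_card => t.
rewrite !inE big_tuple; apply/codomP/idP => [[i ->]|ht].
  under eq_bigr do rewrite tnth_mktuple.
  exact: (valP i).
have hf : (\sum_k ([ffun k => tnth t k] : {ffun 'I_d.+1 -> 'I_N.+1}) k == N)%N.
  by under eq_bigr do rewrite ffunE.
exists (Mindex hf); apply: eq_from_tnth => k.
by rewrite tnth_mktuple ffunE.
Qed.

Lemma multinomial_coef_gt0 (R : realType) (d N : nat) (i : mindex d N) :
  0 < multinomial_coef R i.
Proof.
by rewrite divr_gt0 ?prodr_gt0 ?ltr0n ?fact_gt0 // => k _; rewrite ltr0n fact_gt0.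
Qed.

Lemma bernsteinM (R : realType) (d N : nat) (i j : mindex d N) (b : 'rV[R]_d) :
  bernstein i b * bernstein j b =
  multinomial_coef R i * multinomial_coef R j
    / multinomial_coef R (mindex_add i j) * bernstein (mindex_add i j) b.
Proof.
rewrite /bernstein [RHS]mulrA divfK ?gt_eqF ?multinomial_coef_gt0 //.
rewrite mulrACA -big_split; congr (_ * _).
by apply: eq_bigr => k _; rewrite mindex_addE exprD.
Qed.

Section positive_scaling.
Context d (T : measurableType d) (R : realType).
Variable mu : {measure set T -> \bar R}.
Import HBNNSimple.
Local Open Scope ereal_scope.

(** The supremum of this set is, by definition, the integral of [f] when [f] is
    nonnegative; the integral of a general [f] is the difference of the suprema
    for its positive and negative parts. *)
Definition lower_sums (f : T -> \bar R) : set (\bar R) :=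
  [set sintegral mu h | h in
     [set h : {nnsfun T >-> R} | forall x, (h x)%:E <= f x]]%classic.

(** Scaling by [k^-1] undoes scaling by [k] on the simple functions, so the two
    inclusions are the same argument with [k] and [k^-1]. *)
Lemma lower_sums_pZl (k : R) (f : T -> \bar R) : (0 < k)%R ->
  lower_sums (fun x => k%:E * f x) = [set k%:E * s | s in lower_sums f]%classic.
Proof.
move=> k0; have k'0 : (0 < k^-1)%R by rewrite invr_gt0.
apply/seteqP; split=> [_ [h hf <-]|_ [_ [h hf <-] <-]].
  exists (sintegral mu (scale_nnsfun h (ltW k'0))).
    exists (scale_nnsfun h (ltW k'0)) => // x.
    by rewrite /= EFinM lee_pdivrMl.
  by rewrite sintegralrM muleA -EFinM mulfV ?gt_eqF // mul1e.
exists (scale_nnsfun h (ltW k0)); last by rewrite sintegralrM.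
by move=> x; rewrite /= EFinM lee_pmul2l.
Qed.

(** Without integrability the difference of the integrals of the two parts may
    be [+oo - +oo], whose value is [-oo] by convention; a positive factor fixes
    both infinities, so the identity survives in that case too. *)
Lemma integral_pZl (D : set T) (k : R) (f : T -> \bar R) : (0 < k)%R ->
  \int[mu]_(x in D) (k%:E * f x) = k%:E * \int[mu]_(x in D) f x.
Proof.
move=> k0; rewrite /integral erestrict_scale.
rewrite ge0_funeposM ?ge0_funenegM ?ltW //.
rewrite -!/(lower_sums _) !lower_sums_pZl // !ereal_sup_pZl //.
case: (ereal_sup _) => [a| |]; case: (ereal_sup _) => [b| |] /=;
  rewrite ?(gt0_muley, gt0_muleNy, lte_fin) //.
by congr EFin; rewrite -mulrBr.
Qed.

(** When the extended integral is infinite, both sides are [0], the finite part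
    of an infinite value. *)
Lemma Rintegral_pZl (D : set T) (k : R) (f : T -> R) : (0 < k)%R ->
  (\int[mu]_(x in D) (k * f x) = k * \int[mu]_(x in D) f x)%R.
Proof.
move=> k0; rewrite /Rintegral.
under eq_integral do rewrite EFinM.
rewrite integral_pZl //; case: (integral _ _ _) => [a| |] //=.
  by rewrite gt0_muley ?lte_fin //= mulr0.
by rewrite gt0_muleNy ?lte_fin //= mulr0.
Qed.

End positive_scaling.

Lemma triangle_integral_pZl (R : realType) (w : R) (a : 'I_3 -> 'rV[R]_2)
    (k : R) (f : 'rV[R]_3 -> R) : 0 < k ->
  triangle_integral w a (fun s => k * f s) = k * triangle_integral w a f.
Proof. by move=> k0; rewrite /triangle_integral Rintegral_pZl // mulrCA. Qed.

Theorem proposition3 (R : realType) (m n : nat) (hm : (1 <= m)%N)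
    (hn : (1 <= n)%N)
    (Omega : 'I_3 -> 'rV[R]_2) (hOmega : nondegenerate_simplex Omega)
    (w : R) (hw : 0 < w)
    (Lam : 'I_4 -> 'rV[R]_3) (hLam : nondegenerate_simplex Lam)
    (c : mindex 3 n -> 'rV[R]_3) :
  let p := bezier_triangle Lam c in
  let M := implicitization_matrix w Omega p m in
  let I := fun k : mindex 4 (2 * m) => bernstein_integral w Omega p k in
  [/\ #|{: mindex 4 m}| = 'C(m + 3, 3),
      #|{: mindex 4 (2 * m)}| = 'C(2 * m + 3, 3) &
      forall i j : mindex 4 m,
        M (enum_rank i) (enum_rank j) =
        multinomial_coef R i * multinomial_coef R j / multinomial_coef R (mindex_add i j)
        * I (mindex_add i j)].
Proof.
move=> p M I; split; [exact: card_mindex | exact: card_mindex |] => i j.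
rewrite /M /I /bernstein_integral mxE !enum_rankK -triangle_integral_pZl.
  by congr (triangle_integral w Omega _); apply/funext => s; apply: bernsteinM.
by apply: divr_gt0; [apply: mulr_gt0 |]; apply: multinomial_coef_gt0.
Qed.
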